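(* Let $l\ge1$ be an integer, let $\{m_k\}_{k\ge1}$ be an enumeration (in any order) of the integers in $\mathcal D^*(l)$, let $T=\{t_{n,m}\}$ be a summation matrix satisfying conditions 1)–3) of the context, and let $a_k$, $k\ge1$, be real numbers. If the sums $$\sum_{k}t_{n,k}a_kw_{m_k}(x)$$ converge to zero as $n\to\infty$ for every $x$ in a measurable set $E\subset(0,1)$ of Lebesgue measure $|E|>1-2^{-4l}$, then $a_k=0$ for all $k=1,2,\ldots$.
   Context: For an integer $s\ge1$, $\mathcal D(s)$ is the set of integers of the form $m=2^{k_1}+2^{k_2}+\dots+2^{k_s}$ with integers $k_1>k_2>\dots>k_s\ge1$, and $\mathcal D^*(l)=\bigcup_{1\le s\le l}\mathcal D(s)$. The Rademacher functions are $r_n(x)=\operatorname{sign}(\sin 2^n\pi x)$, $x\in(0,1)$, $n\ge1$, and the Walsh function for such $m$ is $w_m(x)=r_{k_1}(x)r_{k_2}(x)\cdots r_{k_s}(x)$. Conditions on a matrix $T=\{t_{n,m}:\ m\in\mathbb Z,\ n=1,2,\ldots\}$ of numbers: 1) for each $n$ only finitely many of the $t_{n,m}$, $m\in\mathbb Z$, are nonzero; 2) there is a constant $M$ with $|t_{n,m}|\le M$ for all $n,m$; 3) $\lim_{n\to\infty}t_{n,m}=1$ for every $m=1,2,\ldots$. *)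

(* Defs.v *)
From mathcomp Require Import all_boot all_order all_algebra.
From mathcomp Require Import all_classical all_reals all_analysis.
From mathcomp Require Import complex.

Set Implicit Arguments.
Unset Strict Implicit.
Unset Printing Implicit Defensive.

Import Order.TTheory GRing.Theory Num.Theory.
Import numFieldNormedType.Exports.

Local Open Scope classical_set_scope.
Local Open Scope ring_scope.

Definition dyadic_sums (s : nat) : set nat :=
  [set m | exists k : s.-tuple nat,
    [/\ sorted gtn k, all (leq 1) k & m = (\sum_(j <- k) 2 ^ j)%N]].

Definition dyadic_sums_le (l : nat) : set nat :=
  \bigcup_(s in [set s | (1 <= s <= l)%N]) dyadic_sums s.

Definition rademacher (R : realType) (n : nat) (x : R) : R :=
  Num.sg (sin (2 ^+ n * pi * x)).

Definition nat_bit (m j : nat) : bool := odd (m %/ 2 ^ j).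

(* The exponents k_1 > ... > k_s are the positions of the binary digits 1 of m;
   [walsh_dyadic_sum] below recovers w_m = r_(k_1) ... r_(k_s). *)
Definition walsh (R : realType) (m : nat) (x : R) : R :=
  \prod_(1 <= j < m.+1 | nat_bit m j) rademacher j x.

Lemma sum_exp2_lt (h : nat) (k : seq nat) :
  path gtn h k -> (\sum_(j <- k) 2 ^ j < 2 ^ h)%N.
Proof.
elim: k h => [|i k IH] h /=; first by rewrite big_nil expn_gt0.
case/andP=> ih /IH lt_k; rewrite big_cons.
apply: (@leq_trans (2 ^ i.+1)); last by rewrite leq_exp2l.
by rewrite expnS mul2n -addnn ltn_add2l.
Qed.

Lemma nat_bit_sum_exp2 (k : seq nat) (j : nat) :
  sorted gtn k -> nat_bit (\sum_(i <- k) 2 ^ i)%N j = (j \in k).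
Proof.
rewrite /nat_bit; elim: k => [|h k IH] /=; first by rewrite big_nil div0n.
move=> hk; have lt_k := sum_exp2_lt hk.
have {}IH := IH (path_sorted hk).
rewrite big_cons in_cons; have [jh|hj|->] := ltngtP j h.
- by rewrite -(subnK (ltnW jh)) expnD divnMDl ?expn_gt0// oddD IH oddX
             subn_eq0 leqNgt jh.
- rewrite -IH !divn_small//.
    by apply: (ltn_trans lt_k); rewrite ltn_exp2l.
  apply: (@leq_trans (2 ^ h.+1)); last by rewrite leq_exp2l.
  by rewrite expnS mul2n -addnn ltn_add2l.
- by rewrite -{1}[(2 ^ h)%N]mul1n divnMDl ?expn_gt0// divn_small.
Qed.

Lemma walsh_dyadic_sum (R : realType) (k : seq nat) (x : R) :
  sorted gtn k -> all (leq 1) k ->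
  walsh (\sum_(j <- k) 2 ^ j)%N x = \prod_(j <- k) rademacher j x.
Proof.
move=> sk k1; rewrite /walsh -big_filter; apply: perm_big.
apply: uniq_perm; first by rewrite filter_uniq// iota_uniq.
  apply: sorted_uniq sk; last exact: ltnn.
  by move=> a b c /= ab ca; apply: ltn_trans ab.
move=> j; rewrite mem_filter nat_bit_sum_exp2//.
case: (boolP (j \in k)) => //= jk.
rewrite mem_index_iota (allP k1 _ jk) /= ltnS (big_rem j) //=.
exact/(leq_trans (ltnW (ltn_expl _ _)))/leq_addr.
Qed.

(* Summation matrices have rows n >= 1; the values [t 0 m] are irrelevant. *)
Definition summation_matrix (R : realType) (t : nat -> int -> R[i]^o) : Prop :=
  [/\ forall n, (0 < n)%N -> finite_set [set m : int | t n m != 0],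
      exists M : R, forall n m, (0 < n)%N -> `|t n m| <= (M%:C)%C
    & forall m : nat, (0 < m)%N -> t n m%:Z @[n --> \oo] --> (1 : R[i]^o)].

(* Lebesgue (not only Borel) measurability: the domain of
   [completed_lebesgue_measure]. *)
Definition lebesgue_measurable (R : realType) (E : set R) : Prop :=
  ((wlength (idfun : R -> R))^*)%mu.-cara.-measurable E.

(* Main.v *)
(* A Walsh polynomial F of degree at most l satisfies E F^4 <= 9^l (E F^2)^2
   (hypercontractivity), so by Paley-Zygmund |F| is at least half of its L^2
   norm, hence at least half of any of its coefficients, on a set of measure at
   least (9/16) 9^-l >= 2^(-4l). If a_k <> 0, this applies to the real parts of
   all the transformed sums with n large, whose k-th coefficient is close to
   a_k; the limsup of the resulting sets has measure at least 2^(-4l) and so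
   meets E, where the sums should tend to 0. *)
Require Import Defs.
From mathcomp Require Import all_boot all_order all_algebra.
From mathcomp Require Import all_classical all_reals all_analysis.
From mathcomp Require Import complex.
From mathcomp Require Import ring lra.

Import Order.TTheory GRing.Theory Num.Theory.
Import numFieldNormedType.Exports.

Local Open Scope classical_set_scope.
Local Open Scope ring_scope.

(** * Cauchy-Schwarz inequality for finite sums *)

Lemma sum_CauchySchwarz (R : realFieldType) (I : finType) (P : pred I)
    (u v : I -> R) :
  (\sum_(i | P i) u i * v i) ^+ 2 <=
  (\sum_(i | P i) u i ^+ 2) * (\sum_(i | P i) v i ^+ 2).
Proof.
(* By Lagrange's identity this double sum is twice the difference of the two sides. *)
have : 0 <= \sum_(i | P i) \sum_(j | P j) (u i * v j - u j * v i) ^+ 2.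
  by apply: sumr_ge0 => i _; apply: sumr_ge0 => j _; exact: sqr_ge0.
have -> : \sum_(i | P i) \sum_(j | P j) (u i * v j - u j * v i) ^+ 2 =
    \sum_(i | P i) \sum_(j | P j) u i ^+ 2 * v j ^+ 2
    + \sum_(i | P i) \sum_(j | P j) v i ^+ 2 * u j ^+ 2
    - 2 * (\sum_(i | P i) \sum_(j | P j) (u i * v i) * (u j * v j)).
  rewrite mulr_sumr -big_split -sumrB; apply: eq_bigr => i _.
  rewrite mulr_sumr -big_split -sumrB; apply: eq_bigr => j _ /=; ring.
rewrite -!big_distrlr/= -expr2; lra.
Qed.

(** * Walsh polynomials as functions of the rank of a dyadic interval *)

(* For [i < N], the value of [rademacher i.+1] on ]j / 2^N, (j + 1) / 2^N[. *)
Definition rank_sign (R : realType) (N i j : nat) : R :=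
  (-1) ^+ (j %/ 2 ^ (N - i.+1)).

(* The Walsh indices of the theorem are even: [c m] is the coefficient of the
   Walsh function of index [2 m], whose digit [i.+1] is digit [i] of [m]. *)
Definition chaos (R : realType) (N : nat) (c : nat -> R) (j : nat) : R :=
  \sum_(m < 2 ^ N) c m * \prod_(i < N | nat_bit m i) rank_sign R N i j.

(** For m < 2^N this is the degree of the Walsh function of index 2m: the number of its Rademacher
    factors. *)
Definition weight (N m : nat) : nat := \sum_(i < N) nat_bit m i.

Lemma nat_bit_small N m : (m < 2 ^ N)%N -> nat_bit m N = false.
Proof. by move=> mN; rewrite /nat_bit divn_small. Qed.

Lemma nat_bitD N m i : (i < N)%N -> nat_bit (m + 2 ^ N) i = nat_bit m i.
Proof.
move=> iN; rewrite /nat_bit -(subnK (ltnW iN)) expnD addnC divnMDl ?expn_gt0//.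
by rewrite oddD oddX subn_eq0 leqNgt iN.
Qed.

Lemma nat_bitD_top N m : (m < 2 ^ N)%N -> nat_bit (m + 2 ^ N) N.
Proof.
by move=> mN; rewrite /nat_bit divnDr// divnn expn_gt0/= divn_small.
Qed.

Lemma weight_small N m : (m < 2 ^ N)%N -> weight N.+1 m = weight N m.
Proof. by move=> mN; rewrite /weight big_ord_recr/= nat_bit_small// addn0. Qed.

Lemma weightD N m : (m < 2 ^ N)%N -> weight N.+1 (m + 2 ^ N) = (weight N m).+1.
Proof.
move=> mN; rewrite /weight big_ord_recr/= nat_bitD_top// addn1; congr _.+1.
by apply: eq_bigr => i _; rewrite nat_bitD.
Qed.

(** Inductions on N split the coefficient indices by their top digit, but the ranks by their last
    digit ([sum_ord_double]), since interval j has the halves 2j and 2j+1. *)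
Lemma sum_ord_expS (V : nmodType) N (F : nat -> V) :
  \sum_(m < 2 ^ N.+1) F m = \sum_(m < 2 ^ N) (F m + F (m + 2 ^ N)%N).
Proof.
rewrite -(big_mkord xpredT) (big_cat_nat (n := 2 ^ N))//=; last first.
  by rewrite leq_exp2l.
rewrite expnS mul2n -addnn -{2}[(2 ^ N)%N]add0n big_addn addnK !big_mkord.
by rewrite big_split.
Qed.

Lemma sum_ord_double (V : nmodType) n (F : nat -> V) :
  \sum_(m < n.*2) F m = \sum_(m < n) (F m.*2 + F m.*2.+1).
Proof.
elim: n => [|n IH]; first by rewrite !big_ord0.
by rewrite doubleS !big_ord_recr/= IH addrA.
Qed.

(** Rank b + 2j is a half of interval j, and the first N Rademacher functions are constant on that
    interval. *)
Lemma rank_signS (R : realType) N i j (b : bool) : (i < N)%N ->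
  rank_sign R N.+1 i (b + j.*2) = rank_sign R N i j.
Proof.
move=> iN; rewrite /rank_sign subSn// expnS divnMA.
by rewrite divn2 half_bit_double.
Qed.

Lemma rank_signS_last (R : realType) N j (b : bool) :
  rank_sign R N.+1 N (b + j.*2) = (-1) ^+ b.
Proof.
by rewrite /rank_sign subnn divn1 -signr_odd oddD odd_double addbF oddb.
Qed.

Lemma chaos0 (R : realType) (c : nat -> R) j : chaos R 0 c j = c 0%N.
Proof. by rewrite /chaos big_ord1 big_pred0 ?mulr1// => -[]. Qed.

(** Monomials without the last Rademacher function r form g, the others form r h; on the two halves
    of interval j, r is 1 and -1. *)
Lemma chaosS (R : realType) N (c : nat -> R) j (b : bool) :
  chaos R N.+1 c (b + j.*2) =
  chaos R N c j + (-1) ^+ b * chaos R N (fun m => c (m + 2 ^ N)%N) j.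
Proof.
rewrite /chaos (sum_ord_expS _ _ (fun m => c m *
  \prod_(i < N.+1 | nat_bit m i) rank_sign R N.+1 i (b + j.*2))).
rewrite mulr_sumr -big_split; apply: eq_bigr => m _ /=.
have prodS m' (P : pred 'I_N) :
    (forall i, nat_bit m' (widen_ord (leqnSn N) i) = P i) ->
    \prod_(i < N | nat_bit m' (widen_ord (leqnSn N) i))
      rank_sign R N.+1 (widen_ord (leqnSn N) i) (b + j.*2) =
    \prod_(i < N | P i) rank_sign R N i j.
  by move=> bitE; apply: eq_big => // i _; rewrite /= rank_signS.
congr (_ * _ + _).
  rewrite big_mkcond big_ord_recr/= nat_bit_small// mulr1 -big_mkcond/=.
  exact: prodS.
rewrite mulrCA; congr (_ * _).
rewrite big_mkcond big_ord_recr/= nat_bitD_top// -big_mkcond/= rank_signS_last.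
rewrite mulrC; congr (_ * _); apply: prodS => i /=; exact: nat_bitD.
Qed.

Lemma sum_chaosS (R : realType) N (c : nat -> R) (f : R -> R) :
  let g := chaos R N c in let h := chaos R N (fun m => c (m + 2 ^ N)%N) in
  \sum_(j < 2 ^ N.+1) f (chaos R N.+1 c j) =
  \sum_(j < 2 ^ N) (f (g j + h j) + f (g j - h j)).
Proof.
rewrite /= expnS mul2n (sum_ord_double _ _ (fun j => f (chaos R N.+1 c j))).
apply: eq_bigr => j _.
have := chaosS R N c j false; have := chaosS R N c j true.
by rewrite add1n add0n expr0 expr1 mul1r mulN1r => -> ->.
Qed.

(** * Parseval identity, hypercontractivity and Paley-Zygmund *)

Lemma chaos_parseval (R : realType) N (c : nat -> R) :
  \sum_(j < 2 ^ N) chaos R N c j ^+ 2 = 2 ^+ N * \sum_(m < 2 ^ N) c m ^+ 2.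
Proof.
elim: N c => [|N IH] c.
  by rewrite mul1r !big_ord1 chaos0.
rewrite (sum_chaosS _ _ _ (fun x => x ^+ 2)).
rewrite (sum_ord_expS _ _ (fun m => c m ^+ 2)).
rewrite [in RHS]big_split/= exprS -mulrA mulrDr.
rewrite -IH -(IH (fun m => c (m + 2 ^ N)%N)) mulrDr !mulr_sumr -!big_split.
(* Parallelogram identity for g + h and g - h. *)
by apply: eq_bigr => j _ /=; ring.
Qed.

(** Bonami's inequality with averages cleared of denominators. Writing F = g + r h, where g has
    degree at most d and h at most d - 1, the odd powers of r cancel and leave g^4 + 6 g^2 h^2 +
    h^4; Cauchy-Schwarz bounds the mixed term. *)
Lemma chaos_hypercontractive (R : realType) N (d : nat) (c : nat -> R) :
  (forall m, (m < 2 ^ N)%N -> (d < weight N m)%N -> c m = 0) ->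
  2 ^+ N * \sum_(j < 2 ^ N) chaos R N c j ^+ 4 <=
  9 ^+ d * (\sum_(j < 2 ^ N) chaos R N c j ^+ 2) ^+ 2.
Proof.
elim: N d c => [|N IH] d c cd.
  rewrite mul1r !big_ord1 -exprM ler_peMl ?exprn_even_ge0//.
  by rewrite exprn_ege1// ler1n.
rewrite (sum_chaosS _ _ _ (fun x => x ^+ 2)).
rewrite (sum_chaosS _ _ _ (fun x => x ^+ 4)).
rewrite /=; set h := chaos R N (fun m => c (m + 2 ^ N)%N); set g := chaos R N c.
have IHg := IH d c; rewrite -/g in IHg.
have {}IHg : 2 ^+ N * \sum_(j < 2 ^ N) g j ^+ 4 <=
    9 ^+ d * (\sum_(j < 2 ^ N) g j ^+ 2) ^+ 2.
  apply: IHg => m mN dm; apply: cd; last by rewrite weight_small.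
  by rewrite (ltn_trans mN)// ltn_exp2l.
have -> : \sum_(j < 2 ^ N) ((g j + h j) ^+ 2 + (g j - h j) ^+ 2) =
    2 * (\sum_(j < 2 ^ N) g j ^+ 2 + \sum_(j < 2 ^ N) h j ^+ 2).
  by rewrite mulrDr !mulr_sumr -big_split; apply: eq_bigr => j _ /=; ring.
have -> : \sum_(j < 2 ^ N) ((g j + h j) ^+ 4 + (g j - h j) ^+ 4) =
    2 * (\sum_(j < 2 ^ N) g j ^+ 4 + 6 * \sum_(j < 2 ^ N) g j ^+ 2 * h j ^+ 2
         + \sum_(j < 2 ^ N) h j ^+ 4).
  by rewrite !mulrDr !mulr_sumr -!big_split; apply: eq_bigr => j _ /=; ring.
have CS := sum_CauchySchwarz R _ xpredT
  (fun j : 'I_(2 ^ N) => g j ^+ 2) (fun j => h j ^+ 2).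
have sq4 (f : nat -> R) :
    \sum_(j < 2 ^ N) (f j ^+ 2) ^+ 2 = \sum_(j < 2 ^ N) f j ^+ 4.
  by apply: eq_bigr => j _; rewrite -exprM.
rewrite !sq4 in CS.
have ge0 (f : nat -> R) : 0 <= \sum_(j < 2 ^ N) f j ^+ 4.
  by apply: sumr_ge0 => j _; exact: exprn_even_ge0.
have ge02 (f : nat -> R) : 0 <= \sum_(j < 2 ^ N) f j ^+ 2.
  by apply: sumr_ge0 => j _; exact: exprn_even_ge0.
(* In degree 0 there is no room for r: h vanishes and only g remains. *)
case: d cd IHg => [|d] cd IHg.
  have h0 j : h j = 0.
    rewrite /h /chaos big1// => m _; rewrite cd ?mul0r//.
      by rewrite expnS mul2n -addnn ltn_add2r.
    by rewrite weightD.
  rewrite [\sum_j h _ ^+ 4]big1; last by move=> j _; rewrite h0 expr0n.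
  rewrite [\sum_j h _ ^+ 2]big1; last by move=> j _; rewrite h0 expr0n.
  rewrite [\sum_j (_ * h _ ^+ 2)]big1; last first.
    by move=> j _; rewrite h0 expr0n mulr0.
  rewrite mulr0 !addr0 exprS exprMn.
  by rewrite !expr0 !mul1r in IHg *; lra.
have IHh : 2 ^+ N * \sum_(j < 2 ^ N) h j ^+ 4 <=
    9 ^+ d * (\sum_(j < 2 ^ N) h j ^+ 2) ^+ 2.
  apply: IH => m mN dm; apply: cd; last by rewrite weightD.
  by rewrite expnS mul2n -addnn ltn_add2r.
have := ge0 g; have := ge0 h; have := ge02 g; have := ge02 h.
move: IHg IHh CS; set G4 := \sum_j g _ ^+ 4; set H4 := \sum_j h _ ^+ 4.
set A := \sum_j g _ ^+ 2; set B := \sum_j h _ ^+ 2; set X := \sum_j _.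
move=> IHg IHh CS B0 A0 H0 G0.
(* The inductive bounds for g and h multiply to 9^(d+1) A^2 * 9^d B^2, the square of 3 * 9^d * A *
   B. *)
have XAB : 2 ^+ N * X <= 3 * 9 ^+ d * (A * B).
  have [X0|X0] := ltrP X 0.
    apply: (@le_trans _ _ 0); last by rewrite !mulr_ge0// exprn_ge0.
    by rewrite mulr_ge0_le0 ?exprn_ge0// ltW.
  rewrite -(@ler_pXn2r _ 2)// ?nnegrE; last 2 first.
    by rewrite mulr_ge0// exprn_ge0.
    by rewrite !mulr_ge0// exprn_ge0.
  have := ler_pM _ _ IHg IHh; rewrite !mulr_ge0 ?exprn_ge0// => /(_ isT isT) GH.
  apply: le_trans (le_trans _ GH) _.
    by rewrite [leRHS]mulrACA exprMn ler_wpM2l// !exprn_ge0.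
  by rewrite exprS le_eqVlt; apply/orP; left; apply/eqP; ring.
(* Now 6 * 3 * 9^d = 2 * 9^(d+1) is exactly the cross coefficient of 9^(d+1) (A + B)^2; the slack is
   a multiple of 9^d B^2. *)
have QB : 0 <= 9 ^+ d * B ^+ 2 by rewrite mulr_ge0 ?exprn_ge0.
move: IHg; rewrite !(exprS 9) (exprS 2); lra.
Qed.

(* Paley-Zygmund: split the second moment at half of its mean square and apply
   Cauchy-Schwarz to the part above. *)
Lemma chaos_large_card (R : realType) N (d : nat) (c : nat -> R) (m0 : nat) :
  (0 < d)%N -> (m0 < 2 ^ N)%N -> c m0 != 0 ->
  (forall m, (m < 2 ^ N)%N -> (d < weight N m)%N -> c m = 0) ->
  2 ^+ N * 2 ^- (4 * d) <=
  #|[pred j : 'I_(2 ^ N) | `|c m0| / 2 <= `|chaos R N c j| ]|%:R :> R.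
Proof.
move=> d0 m0N c0 cd.
set G := [pred j | _]; pose F := chaos R N c.
pose Q := \sum_(j < 2 ^ N) F j ^+ 2.
have QE : Q = 2 ^+ N * \sum_(m < 2 ^ N) c m ^+ 2 by rewrite /Q chaos_parseval.
have P0 : 0 < 2 ^+ N :> R by rewrite exprn_gt0.
(* By Parseval one coefficient bounds the mean square from below, so the threshold defining G is at
   most half the root mean square. *)
have Qc : 2 ^+ N * c m0 ^+ 2 <= Q.
  rewrite QE ler_pM2l// (bigD1 (Ordinal m0N))//= lerDl.
  by apply: sumr_ge0 => i _; exact: sqr_ge0.
have Q0 : 0 < Q by rewrite (lt_le_trans _ Qc)// mulr_gt0// exprn_even_gt0.
have small : \sum_(j | j \notin G) F j ^+ 2 <= Q / 4.
  apply: (@le_trans _ _ (\sum_(j < 2 ^ N) c m0 ^+ 2 / 4)).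
    rewrite [leRHS](bigID (fun j => j \notin G))/= -[leLHS]addr0 lerD//.
      apply: ler_sum => j; rewrite inE -ltNge => Fj.
      rewrite -real_normK ?num_real// -[c m0 ^+ 2]real_normK ?num_real//.
      have := ltW Fj; rewrite -/(F j) => {}Fj.
      have -> : `|c m0| ^+ 2 / 4 = (`|c m0| / 2) ^+ 2 by field.
      by rewrite ler_pXn2r ?nnegrE// divr_ge0.
    by apply: sumr_ge0 => j _; rewrite divr_ge0// sqr_ge0.
  rewrite sumr_const card_ord -[leLHS]mulr_natl natrX mulrA ler_pM2r//.
have large : 3 / 4 * Q <= \sum_(j in G) F j ^+ 2.
  have : Q = \sum_(j in G) F j ^+ 2 + \sum_(j | j \notin G) F j ^+ 2.
    by rewrite /Q (bigID (mem G)).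
  lra.
have CS := sum_CauchySchwarz R _ (mem G) (fun=> 1)
  (fun j : 'I_(2 ^ N) => F j ^+ 2).
have H4 : \sum_(j in G) (F j ^+ 2) ^+ 2 <= \sum_(j < 2 ^ N) F j ^+ 4.
  rewrite [leRHS](bigID (mem G))/=.
  under eq_bigr do rewrite -exprM.
  by rewrite lerDl; apply: sumr_ge0 => j _; exact: exprn_even_ge0.
have HC := chaos_hypercontractive R N d c cd; rewrite -/F -/Q in HC.
rewrite (eq_bigr _ (fun _ _ => mul1r _)) in CS.
rewrite (eq_bigr _ (fun _ _ => expr1n _ _)) in CS.
rewrite sumr_const in CS.
have S4 : 0 <= \sum_(j < 2 ^ N) F j ^+ 4.
  by apply: sumr_ge0 => j _; exact: exprn_even_ge0.
set S := \sum_(j < 2 ^ N) _ in H4 HC S4; set g : R := #|G|%:R in CS *.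
have g0 : 0 <= g by exact: ler0n.
have gS : (3 / 4 * Q) ^+ 2 <= g * S.
  apply: le_trans (le_trans CS (ler_wpM2l g0 H4)).
  have Q34 : 0 <= 3 / 4 * Q by rewrite mulr_ge0// ltW.
  by apply: lerXn2r => //; rewrite nnegrE (le_trans Q34).
(* Hypercontractivity bounds the fourth moment by a multiple of Q^2, which then cancels. *)
have {HC gS} : 2 ^+ N * (3 / 4) ^+ 2 <= g * 9 ^+ d.
  rewrite -(ler_pM2r (exprn_gt0 2 Q0)) -[leRHS]mulrA.
  have -> : 2 ^+ N * (3 / 4) ^+ 2 * Q ^+ 2 = 2 ^+ N * (3 / 4 * Q) ^+ 2 by ring.
  apply: (@le_trans _ _ (2 ^+ N * (g * S))); first by rewrite ler_pM2l.
  by rewrite mulrCA ler_wpM2l.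
(* That is, (9/16) 9^-d >= 16^-d, with equality at d = 1; it would fail at d = 0. *)
have p16 : 9 ^+ d * 16 <= 9 * 16 ^+ d :> R.
  case: d d0 {cd} => // d _; rewrite !exprS -mulrA ler_pM2l// mulrC ler_pM2l//.
  by rewrite lerXn2r ?nnegrE// ler_nat.
rewrite ler_pdivrMr ?exprn_gt0// exprM => H.
have -> : 2 ^+ 4 = 16 :> R by ring.
have := ler_wpM2l g0 p16; lra.
Qed.

(** * Walsh functions on dyadic intervals *)

(** Open, since at a dyadic endpoint a Rademacher function can be 0 instead of 1 or -1. *)
Definition dyadic_itv (R : realType) (N j : nat) : set R :=
  `](j%:R / 2 ^+ N), (j.+1%:R / 2 ^+ N)[.

Lemma sgr_sin_pi (R : realType) (q : nat) (y : R) :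
  q%:R < y < q.+1%:R -> Num.sg (sin (y * pi)) = (-1) ^+ q.
Proof.
move=> /andP[qy yq].
have -> : y * pi = (y - q%:R) * pi + pi *+ q :> R.
  by rewrite mulrBl mulr_natl subrK.
rewrite (alternatingn (@sinDpi R)) sgrM sgrX sgrN1.
rewrite (gtr0_sg (x := sin _)) ?mulr1//.
apply: sin_gt0_pi; rewrite mulr_gt0 ?pi_gt0 ?subr_gt0//=.
by rewrite gtr_pMl ?pi_gt0// ltrBlDl -natr1 in yq *.
Qed.

(** With K = 2^(N-i-1), the point 2^(i+1) x lies between j/K and (j+1)/K, hence strictly between the
    integer part q of j/K and q + 1. *)
Lemma rademacher_dyadic_itv (R : realType) (N i j : nat) (x : R) :
  (i < N)%N -> dyadic_itv R N j x -> rademacher i.+1 x = rank_sign R N i j.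
Proof.
move=> iN; rewrite /dyadic_itv /= in_itv/= => /andP[jx xj].
rewrite /rademacher /rank_sign mulrAC; apply: sgr_sin_pi.
set K := (2 ^ (N - i.+1))%N.
have K0 : 0 < K%:R :> R by rewrite ltr0n expn_gt0.
have NK : 2 ^+ N = K%:R * 2 ^+ i.+1 :> R by rewrite natrX -exprD subnK.
have N0 : 0 < 2 ^+ N :> R by rewrite exprn_gt0.
rewrite ltr_pdivrMr// in jx; rewrite ltr_pdivlMr// in xj.
have y : x * 2 ^+ N = K%:R * (2 ^+ i.+1 * x) by rewrite NK mulrC mulrA.
rewrite {}y in jx xj; have Kn : (0 < K)%N by rewrite expn_gt0.
apply/andP; split.
  rewrite -(ltr_pM2l K0); apply: le_lt_trans jx.
  by rewrite -natrM ler_nat mulnC leq_divM.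
rewrite -(ltr_pM2l K0); apply: (lt_le_trans xj).
by rewrite -natrM ler_nat mulnC ltn_ceil.
Qed.

Lemma nat_bit_doubleS m i : nat_bit m.*2 i.+1 = nat_bit m i.
Proof. by rewrite /nat_bit expnS divnMA -muln2 mulnK. Qed.

(** The crude bound [m.*2 <= N] allows the product defining [walsh] to be widened to N factors; the
    digits so added are 0. *)
Lemma walsh_dyadic_itv (R : realType) (N j m : nat) (x : R) :
  (m.*2 <= N)%N -> dyadic_itv R N j x ->
  walsh m.*2 x = \prod_(i < N | nat_bit m i) rank_sign R N i j.
Proof.
move=> mN xj; rewrite /walsh big_add1/= big_mkord.
rewrite (big_ord_widen_cond _ (fun i => nat_bit m.*2 i.+1)
  (fun i => rademacher i.+1 x) mN).
apply: eq_big => [i|i _]; last exact: rademacher_dyadic_itv.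
rewrite nat_bit_doubleS; case: ltnP => im; rewrite (andbT, andbF)//.
rewrite /nat_bit divn_small//; apply: leq_ltn_trans (ltn_expl i (ltnSn 1)).
by rewrite (leq_trans _ im)// -addnn leq_addr.
Qed.

(** * Binary digits of the indices in D*(l) *)

Lemma dyadic_sums_even l m : dyadic_sums_le l m -> m./2.*2 = m.
Proof.
move=> [s _ [k [_ /allP k1 ->]]]; rewrite even_halfK// big_seq.
elim/big_ind : _ => // [p q /negbTE p0 /negbTE q0|i /k1].
  by rewrite oddD p0 q0.
by case: i => // i _; rewrite oddX.
Qed.

(** Digit i of [m./2] is 1 exactly when i + 1 is one of the at most l exponents. *)
Lemma dyadic_sums_weight l N m : dyadic_sums_le l m -> (weight N m./2 <= l)%N.
Proof.
move=> lm; have := dyadic_sums_even _ _ lm.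
case: lm => s /andP[_ sl] [k [ks _ mE]] m2.
have bitE i : nat_bit m./2 i = (i.+1 \in k).
  by rewrite -nat_bit_doubleS m2 mE nat_bit_sum_exp2.
rewrite /weight; under eq_bigr do rewrite bitE.
apply: leq_trans sl; rewrite -{2}(size_tuple k).
rewrite -(big_mkord xpredT (fun i => nat_of_bool (i.+1 \in k))).
rewrite -(big_add1 _ _ 0 N.+1 xpredT (fun i => nat_of_bool (i \in k))).
rewrite -(big_mkcond (fun i => i \in k) (fun=> 1%N)) /=.
rewrite sum1_count -size_filter; apply: uniq_leq_size.
  by rewrite filter_uniq// iota_uniq.
by move=> i; rewrite mem_filter => /andP[].
Qed.

(** * Measure of unions of dyadic intervals *)

Lemma trivIset_dyadic_itv (R : realType) N (D : set 'I_(2 ^ N)) :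
  trivIset D (fun j => dyadic_itv R N j).
Proof.
move=> i j _ _ [x []]; rewrite /dyadic_itv/= !in_itv/=.
move=> /andP[ix xi] /andP[jx xj].
have N0 : 0 < (2 ^+ N)^-1 :> R by rewrite invr_gt0 exprn_gt0.
apply/val_inj/eqP => /=; rewrite eqn_leq -(ltnS i j) -(ltnS j i) -!(ltr_nat R).
apply/andP; split; rewrite -(ltr_pM2r N0).
  exact: lt_trans ix _.
exact: lt_trans jx _.
Qed.

Lemma lebesgue_measure_dyadic_itv (R : realType) N j :
  lebesgue_measure (dyadic_itv R N j) = (2 ^- N)%:E.
Proof.
rewrite lebesgue_measure_itv/= lte_fin ltr_pM2r ?invr_gt0 ?exprn_gt0//.
by rewrite ltr_nat ltnSn -EFinB -mulrBl -natrB// subSnn mul1r.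
Qed.

Lemma dyadic_itv_sub01 (R : realType) N (j : 'I_(2 ^ N)) :
  dyadic_itv R N j `<=` [set x | 0 < x < 1].
Proof.
move=> x; rewrite /dyadic_itv/= in_itv/= => /andP[jx xj].
have N0 : 0 < 2 ^+ N :> R by rewrite exprn_gt0.
rewrite (le_lt_trans _ jx) ?divr_ge0 ?ler0n ?ltW//=.
by rewrite (lt_le_trans xj)// ler_pdivrMr// mul1r -natrX ler_nat.
Qed.

Lemma lebesgue_measure_bigcup_dyadic_itv (R : realType) N
    (P : pred 'I_(2 ^ N)) :
  lebesgue_measure (\bigcup_(j in [set j : 'I_(2 ^ N) | P j]) dyadic_itv R N j)
  = (#|P|%:R / 2 ^+ N)%:E.
Proof.
rewrite measure_fin_bigcup//=; last 2 first.
- exact: trivIset_dyadic_itv.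
- by move=> j _; exact: measurable_itv.
under eq_fsbigr do rewrite lebesgue_measure_dyadic_itv.
have -> : [set j | P j] = [set` enum P].
  by apply/seteqP; split=> j /=; rewrite mem_enum.
rewrite -fsbig_seq ?enum_uniq// big_enum/= sumEFin sumr_const.
by rewrite mulr_natl.
Qed.

(** * Finite Walsh sums are large on a set of measure at least 2^(-4l) *)

Lemma walsh_sum_large (R : realType) l (m : nat -> nat) (r : seq nat)
    (b : nat -> R) (k0 : nat) :
  (0 < l)%N -> uniq r -> {in r &, injective m} ->
  (forall k, k \in r -> dyadic_sums_le l (m k)) -> k0 \in r -> b k0 != 0 ->
  exists G : set R, [/\ measurable G, G `<=` [set x | 0 < x < 1],
    ((2 ^- (4 * l))%:E <= lebesgue_measure G)%E &
    forall x, G x -> `|b k0| / 2 <= `|\sum_(k <- r) b k * walsh (m k) x|].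
Proof.
move=> l0 ur mI rm k0r b0.
pose N := \max_(k <- r) m k.
have mN k : k \in r -> (m k <= N)%N by move=> kr; exact: leq_bigmax_seq.
have m2 k : k \in r -> (m k)./2.*2 = m k by move=> /rm/dyadic_sums_even.
have m2N k : k \in r -> ((m k)./2 < 2 ^ N)%N.
  move=> kr; apply: leq_ltn_trans (ltn_expl N (ltnSn 1)).
  by rewrite (leq_trans _ (mN k kr))// -{2}(m2 k kr) -addnn leq_addr.
(* Coefficients are reindexed by halved Walsh index; as m is injective on r, each sum has at most
   one term. *)
pose c (i : nat) := \sum_(k <- r | (m k)./2 == i) b k.
have cE : c (m k0)./2 = b k0.
  rewrite /c big_mkcond (bigD1_seq k0)//= eqxx big1_seq ?addr0//.
  move=> k /andP[/eqP kk0 kr]; case: eqP => // mk.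
  by case: kk0; apply: mI => //; rewrite -m2// mk m2.
have cd i : (i < 2 ^ N)%N -> (l < weight N i)%N -> c i = 0.
  move=> _ li; rewrite /c big1_seq// => k /andP[/eqP mk kr].
  by move: li; rewrite -mk ltnNge (dyadic_sums_weight _ _ _ (rm k kr)).
have sumE j x : dyadic_itv R N j x ->
    \sum_(k <- r) b k * walsh (m k) x = chaos R N c j.
  move=> xj; rewrite /chaos.
  under [RHS]eq_bigr do rewrite /c big_mkcond mulr_suml.
  rewrite exchange_big/= !big_seq; apply: eq_bigr => k kr.
  rewrite (bigD1 (Ordinal (m2N k kr)))//= eqxx [X in _ = _ + X]big1 ?addr0.
    by rewrite -{1}(m2 k kr) (@walsh_dyadic_itv _ N j)// m2// mN.
  by move=> i; rewrite -val_eqE/= eq_sym => /negbTE->; rewrite mul0r.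
pose P := [pred j : 'I_(2 ^ N) | `|b k0| / 2 <= `|chaos R N c j| ].
exists (\bigcup_(j in [set j : 'I_(2 ^ N) | P j]) dyadic_itv R N j); split.
- by apply: fin_bigcup_measurable => // j _; exact: measurable_itv.
- by move=> x [j _]; exact: dyadic_itv_sub01.
- rewrite (lebesgue_measure_bigcup_dyadic_itv _ _ P).
  rewrite lee_fin ler_pdivlMr ?exprn_gt0//.
  rewrite mulrC; have := chaos_large_card R N l c (m k0)./2 l0 (m2N _ k0r).
  by rewrite cE; exact.
- by move=> x [j /= Pj xj]; rewrite (sumE j).
Qed.

(** * Limsup sets and real parts of the transformed sums *)

(** The unions of the tails decrease to the limsup, each has measure at least e, and finiteness of
    mu A gives continuity from above. *)
Lemma measure_lim_sup_set_ge d (T : measurableType d) (R : realType)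
    (mu : {measure set T -> \bar R}) (F : (set T)^nat) (A : set T)
    (e : \bar R) :
  (forall n, measurable (F n)) -> measurable A -> (mu A < +oo)%E ->
  (forall n, F n `<=` A) -> (forall n, e <= mu (F n))%E ->
  (e <= mu (lim_sup_set F))%E.
Proof.
move=> mF mA Aoo FA eF.
have mU n : measurable (\bigcup_(k in [set k | (n <= k)%N]) F k).
  by apply: bigcup_measurable.
apply: (cvge_ge _ (lim_sup_set_cvg mu F mF _)).
  apply: nearW => n; apply: (le_trans (eF n)).
  by apply: le_measure; rewrite ?inE//; apply: bigcup_sup => /=.
apply: le_lt_trans Aoo; apply: le_measure; rewrite ?inE//.
by apply: bigcup_sub.
Qed.

Lemma Re_sum (R : rcfType) (I : Type) (r : seq I) (F : I -> R[i]) :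
  complex.Re (\sum_(i <- r) F i) = \sum_(i <- r) complex.Re (F i).
Proof. exact: (raddf_sum (@complex.Re R)). Qed.

Lemma cvg_Re (R : realType) (u : nat -> R[i]^o) (z : R[i]^o) :
  u n @[n --> \oo] --> z ->
  complex.Re (u n) @[n --> \oo] --> (complex.Re z : R).
Proof.
move=> uz; apply/cvgrPdist_lt => e e0.
have e0' : 0 < (e%:C)%C :> R[i] by rewrite ltcR.
move/cvgrPdist_lt : uz => /(_ _ e0'); apply: filterS => n uze.
rewrite -(raddfB (@complex.Re R)) -ltcR; apply: le_lt_trans uze.
exact: normc_ge_Re.
Qed.

(** The list r is the support of the row t alone, so the same r serves for every x. *)
Lemma Re_sum_fsbig (R : realType) (m : nat -> nat) (a : nat -> R) (x : R)
    (t : int -> R[i]^o) (r : seq nat) : uniq r ->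
  [set` r] = [set k | (0 < k)%N /\ t k%:Z != 0] ->
  complex.Re (\sum_(k \in [set k | (0 < k)%N])
     t k%:Z * ((a k * walsh (m k) x)%:C)%C) =
  \sum_(k <- r) complex.Re (t k%:Z) * a k * walsh (m k) x.
Proof.
move=> ur rE.
rewrite -(fsbig_widen [set` r]); last 2 first.
- by rewrite rE => k [].
- move=> k []; rewrite rE /= => k0 /not_andP[//|/negP/negPn/eqP->].
  by rewrite mul0r.
rewrite -fsbig_seq// Re_sum; apply: eq_bigr => k _.
by case: (t k%:Z) => p q /=; rewrite mulr0 subr0 mulrA.
Qed.

(** * The uniqueness theorem *)

Theorem theorem1p6 (R : realType) (l : nat) (m : nat -> nat)
    (t : nat -> int -> R[i]^o) (a : nat -> R) (E : set R)
    (hl : (1 <= l)%N)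
    (hm : set_bij [set k | (0 < k)%N] (dyadic_sums_le l) m)
    (ht : summation_matrix t)
    (hEm : lebesgue_measurable E)
    (hE01 : E `<=` [set x | 0 < x < 1])
    (hE : ((1 - 2 ^- (4 * l))%:E < completed_lebesgue_measure E)%E)
    (hcvg : forall x, E x ->
      \sum_(k \in [set k | (0 < k)%N]) t n k%:Z * ((a k * walsh (m k) x)%:C)%C
        @[n --> \oo] --> (0 : R[i]^o)) :
  forall k, (0 < k)%N -> a k = 0.
Proof.
move=> k0 k00; apply/eqP/negPn/negP => ak0.
have [tfin _ /(_ _ k00)/cvg_Re/= t1] := ht.
case: hm => mfun minj _.
pose f n x := \sum_(k \in [set k | (0 < k)%N])
  t n k%:Z * ((a k * walsh (m k) x)%:C)%C.
have {t1} [n0 _ t1] : \forall n \near \oo, 1 / 2 < complex.Re (t n k0%:Z).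
  by apply: (cvgr_gt 1) => //; lra.
(* The factor 1/4 is the 1/2 of [walsh_sum_large] times the lower bound 1/2 for the real part of t.
   Row n0 + n + 1 is past n0 and is never row 0. *)
have largeG n : exists G : set R, [/\ measurable G, G `<=` [set x | 0 < x < 1],
    ((2 ^- (4 * l))%:E <= lebesgue_measure G)%E &
    forall x, G x -> `|a k0| / 4 <= `|complex.Re (f (n0 + n.+1)%N x)|].
  set n' := (n0 + n.+1)%N.
  have n'0 : (0 < n')%N by rewrite /n' addnS.
  have /finite_fsetP[X XE] : finite_set [set k | (0 < k)%N /\ t n' k%:Z != 0].
    apply: (@sub_finite_set _ _ (Posz @^-1` [set z | t n' z != 0])).
      by move=> k [].
    by apply: finite_preimage (tfin _ n'0) => i j _ _ [].
  pose r : seq nat := finmap.enum_fset X.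
  have ur : uniq r by exact: finmap.fset_uniq.
  have kX k : k \in r <-> (0 < k)%N /\ t n' k%:Z != 0.
    by have := congr1 (fun S => S k) XE => /= ->.
  have tk0 : 1 / 2 < complex.Re (t n' k0%:Z).
    by apply: t1; rewrite /n' /= leq_addr.
  have [|||||G [mG G01 muG GP]] := walsh_sum_large R l m r
      (fun k => complex.Re (t n' k%:Z) * a k) k0 hl.
  - exact: ur.
  - by move=> i j /kX[i0 _] /kX[j0 _]; apply: minj; rewrite inE.
  - by move=> k /kX[kp _]; exact: mfun.
  - apply/kX; split=> //; apply/eqP => t0; move: tk0; rewrite t0/=; lra.
  - by rewrite mulf_neq0// gt_eqF//; lra.
  exists G; split=> // x /GP; rewrite -(Re_sum_fsbig _ _ _ _ (t n'))//.
  apply: le_trans; rewrite normrM (gtr0_norm (x := complex.Re _)); last by lra.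
  have := normr_ge0 (a k0); nra.
have [G GP] := choice largeG.
have mG n : measurable (G n) by case: (GP n).
pose H := lim_sup_set G.
have mH : measurable H.
  by apply: bigcap_measurable => // n _; exact: bigcup_measurable.
have I01 : [set x : R | 0 < x < 1] = `]0, 1[%classic.
  by apply/seteqP; split=> x /=; rewrite in_itv.
have muI : lebesgue_measure [set x : R | 0 < x < 1] = 1%E.
  by rewrite I01 lebesgue_measure_itv/= lte_fin ltr01 oppr0 adde0.
have mI : measurable ([set x : R | 0 < x < 1] : set (measurableTypeR R)).
  by rewrite I01; exact: measurable_itv.
have muH : ((2 ^- (4 * l))%:E <= lebesgue_measure H)%E.
  apply: (measure_lim_sup_set_ge _ _ _ lebesgue_measure _ _ _ mG mI).
  - by rewrite [ltLHS]muI ltry.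
  - by move=> n; case: (GP n).
  - by move=> n; case: (GP n).
(* A point of H lies in G n for arbitrarily large n, which keeps the sums away from 0; on E they
   tend to 0. *)
have EH0 : E `&` H = set0.
  apply/seteqP; split=> // x [Ex Hx].
  have := cvg_Re _ _ _ (hcvg x Ex) => /cvgr0Pnorm_lt/(_ (`|a k0| / 4)).
  rewrite divr_gt0 ?normr_gt0// => /(_ isT)[N _ small].
  have [n /= Nn Gx] := Hx N I.
  have [_ _ _ /(_ x Gx)] := GP n; rewrite leNgt => /negP; apply.
  by apply: small => /=; rewrite (leq_trans Nn)// addnS ltnW// ltnS leq_addl.
have H01 : H `<=` [set x | 0 < x < 1].
  by move=> x /(_ 0%N I)[n _ Gx]; have [_ + _ _] := GP n; exact.
(* E is only Lebesgue measurable, so additivity is applied to the completed measure, which agrees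
   with [lebesgue_measure] by conversion. *)
have mHc : lebesgue_measurable H by exact: sub_caratheodory.
have := measureU (@completed_lebesgue_measure R) hEm mHc EH0.
move=> muEH.
have : (completed_lebesgue_measure (E `|` H) <= 1)%E.
  rewrite -muI -[lebesgue_measure _]/(completed_lebesgue_measure _).
  apply: le_measure; rewrite ?inE.
  - exact: measurableU.
  - exact: sub_caratheodory.
  - by rewrite subUset.
(* The disjoint sets E and H would have total measure above (1 - 2^(-4l)) + 2^(-4l) = 1. *)
apply/negP; rewrite -ltNge muEH.
rewrite [X in (_ < _ + X)%E]/(lebesgue_measure H).
apply: lt_le_trans (leeD (lexx _) muH).
by rewrite -lteBlDr// -EFinB.
Qed.
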